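(* Let $(X,d)$ be a metric space and $f:X\to X$ a perfect mapping. Then $c(f)\le h_d(f)$, where $c(f)$ is the co-compact entropy of $f$ and $h_d(f)$ is Bowen's entropy of $f$ with respect to $d$.
   Context: A continuous mapping between Hausdorff spaces is called perfect if it is a closed mapping and all its fibers (preimages of single points of the codomain) are compact. All spaces are non-empty. Co-compact entropy. An open set $U\subseteq X$ is co-compact if $X\setminus U$ is a compact subset of $X$. A co-compact open cover of $X$ is an open cover of $X$ all of whose elements are co-compact. Every co-compact open cover has a finite subcover. For a co-compact open cover $\mathcal{U}$ of $X$, $N(\mathcal{U})$ is the smallest cardinality of a subcover of $\mathcal{U}$, and $H(\mathcal{U})=\log N(\mathcal{U})$. For covers $\mathcal{U},\mathcal{V}$, $\mathcal{U}\bigvee\mathcal{V}=\{U\cap V: U\in\mathcal{U}, V\in\mathcal{V}\}$, and $f^{-i}(\mathcal{U})=\{f^{-i}(U):U\in\mathcal{U}\}$ (preimages under the $i$-th iterate). For a perfect mapping $f:X\to X$, $$c(f,\mathcal{U})=\lim_{n\to\infty}\frac1n H\Big(\bigvee_{i=0}^{n-1}f^{-i}(\mathcal{U})\Big)$$ (this limit exists), and $c(f)=\sup_{\mathcal{U}}c(f,\mathcal{U})\in[0,\infty]$ over all co-compact open covers $\mathcal{U}$ of $X$. Bowen's entropy. Let $K\subseteq X$ be a non-empty compact set, $n\ge1$, $\epsilon>0$. A set $F\subseteq X$ is an $(n,\epsilon)$-spanning set of $K$ relative to $f$ if for every $x\in K$ there is $y\in F$ with $d(f^j(x),f^j(y))\le\epsilon$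 for all $0\le j<n$. Let $r_n(\epsilon,K,f)$ be the minimum cardinality of an $(n,\epsilon)$-spanning set of $K$ relative to $f$ (it is finite). Put $r(\epsilon,K,f)=\limsup_{n\to\infty}\frac1n\log r_n(\epsilon,K,f)$, $r(K,f)=\lim_{\epsilon\to0}r(\epsilon,K,f)$, and $h_d(f)=\sup_K r(K,f)\in[0,\infty]$, the supremum being over all non-empty compact subsets $K$ of $X$. *)

(* Defs.v *)
From HB Require Import structures.
From mathcomp Require Import all_boot all_order all_algebra.
From mathcomp Require Import all_classical all_reals all_analysis.

Set Implicit Arguments.
Unset Strict Implicit.
Unset Printing Implicit Defensive.

Import Order.TTheory GRing.Theory Num.Theory.
Import numFieldNormedType.Exports.

Local Open Scope classical_set_scope.
Local Open Scope ring_scope.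

(* Perfectness is meant between Hausdorff spaces; metric spaces are Hausdorff by
   [metric_hausdorff]. *)
Definition perfect_map (X Y : topologicalType) (f : X -> Y) : Prop :=
  [/\ continuous f,
      forall A : set X, closed A -> closed (f @` A)
    & forall y : Y, compact (f @^-1` [set y])].

(* The least cardinality of a set satisfying [P]; the infimum is that of a set
   of natural numbers, hence a minimum, and is +oo when no finite set satisfies
   [P]. *)
Definition min_card (R : realType) (T : Type) (P : set (set T)) : \bar R :=
  ereal_inf [set (n%:R)%:E | n in [set n | exists2 A, P A & (A #= `I_n)%card]].

Section cocompact_entropy.
Context (R : realType) (X : topologicalType).
Implicit Types (f : X -> X) (U V : set (set X)).

Definition is_cover U : Prop := \bigcup_(A in U) A = [set: X].

Definition cocompact_open_cover U : Prop :=
  is_cover U /\ forall A, U A -> open A /\ compact (~` A).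

Definition cover_join U V : set (set X) :=
  [set W | exists A B, [/\ U A, V B & W = A `&` B]].

Definition cover_preimage f U : set (set X) := [set f @^-1` A | A in U].

(* The trivial cover {X} is neutral for the join, so starting from it changes
   nothing for n >= 1. *)
Definition iterated_join f U (n : nat) : set (set X) :=
  \big[cover_join/[set setT]]_(i < n) cover_preimage (iter i f) U.

Definition cover_number U : \bar R :=
  min_card R [set V | V `<=` U /\ is_cover V].

Definition cover_entropy U : \bar R := lne (cover_number U).

(* At n = 0 the term is 0 because 0^-1 = 0; it is irrelevant to the limit. *)
Definition cocompact_entropy_cover f U : \bar R :=
  limn (fun n => ((n%:R : R)^-1)%:E * cover_entropy (iterated_join f U n))%E.

Definition cocompact_entropy f : \bar R :=
  ereal_sup [set cocompact_entropy_cover f U | U in cocompact_open_cover].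

End cocompact_entropy.

Section bowen_entropy.
Context (R : realType) (X : metricType R).
Implicit Types (f : X -> X) (K F : set X) (e : R).

Definition spanning_set f (n : nat) e K F : Prop :=
  forall x, K x -> exists2 y, F y &
    forall j : nat, (j < n)%N -> mdist (iter j f x) (iter j f y) <= e.

Definition spanning_number f (n : nat) e K : \bar R :=
  min_card R (spanning_set f n e K).

Definition bowen_entropy_scale f K e : \bar R :=
  limn_esup (fun n => ((n%:R : R)^-1)%:E * lne (spanning_number f n e K))%E.

Definition bowen_entropy_compact f K : \bar R :=
  lim (bowen_entropy_scale f K e @[e --> (0 : R)^'+]).

Definition bowen_entropy f : \bar R :=
  ereal_sup [set bowen_entropy_compact f K | K in
    [set K | K !=set0 /\ compact K]].

End bowen_entropy.

(* Main.v *)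
(* Fix a co-compact open cover [U], a member [A0] of it, and a Lebesgue number
   [e] of [U]: every closed ball of radius [e] in [X] lies in a member of [U].
   Let [K] be compact, non-empty, and contain the complement of [A0].  A point
   whose orbit first enters [K] at time [i] stays in [A0] before [i] and then
   follows the orbit of a point of an [(n, e)]-spanning set of [K]; hence the
   [n]-th iterated join of [U] has a subcover with at most
   [(n + 1) r_n(e, K, f)] members, and the factor [n + 1] does not contribute
   to the growth rate. *)
Require Import Defs.
From mathcomp Require Import all_boot all_order all_algebra.
From mathcomp Require Import all_classical all_reals all_analysis.
From mathcomp Require Import lra.

Set Implicit Arguments.
Unset Strict Implicit.
Unset Printing Implicit Defensive.

Import Order.TTheory GRing.Theory Num.Theory.
Import numFieldNormedType.Exports.

Local Open Scope classical_set_scope.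
Local Open Scope ereal_scope.

Lemma card_eq_I_enum (T : choiceType) (x0 : T) (A : set T) (m : nat) :
  (A #= `I_m)%card -> exists h : nat -> T, A `<=` h @` `I_m.
Proof.
move=> /card_set_bijP[p [pA pinj _]].
exists (fun k => xget x0 (A `&` p @^-1` [set k])) => x Ax.
exists (p x); first exact: pA.
case: xgetP => [y -> [Ay pyx]|/(_ x)[]//].
by apply: pinj => //; rewrite inE.
Qed.

Section min_card.
Context (R : realType) (T : Type).
Implicit Types (P Q : set (set T)).

Lemma min_card_ge0 P : 0 <= min_card R P.
Proof. by apply: le_ereal_inf_tmp => _ [n _ <-]; rewrite lee_fin ler0n. Qed.

Lemma min_card_le P A n : P A -> (A #= `I_n)%card ->
  min_card R P <= (n%:R)%:E.
Proof. by move=> PA An; apply: ereal_inf_lbound; exists n => //; exists A. Qed.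

Lemma min_card_subset P Q : P `<=` Q -> min_card R Q <= min_card R P.
Proof.
move=> PQ; apply: le_ereal_inf => _ [n [A PA An] <-].
by exists n => //; exists A => //; exact: PQ.
Qed.

Lemma min_card_ge1 P : (forall A, P A -> A !=set0) -> 1 <= min_card R P.
Proof.
move=> P0; apply: le_ereal_inf_tmp => _ [[|n] [A PA An] <-].
  move: An; rewrite II0 card_eq0 => /eqP A0.
  by have [x] := P0 _ PA; rewrite A0.
by rewrite lee_fin ler1n.
Qed.

(** Indices are counted rather than values, so [g] need not be injective. *)
Lemma min_card_image_le P (S : Type) (A : set S) (g : S -> T) n :
  (A #<= `I_n)%card -> P (g @` A) -> min_card R P <= (n%:R)%:E.
Proof.
move=> An PgA; have gAn := card_le_trans (card_image_le g A) An.
have /finite_setP[k gAk] : finite_set (g @` A).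
  exact: card_le_finite gAn (finite_II n).
apply: (le_trans (min_card_le PgA gAk)).
by rewrite lee_fin ler_nat -card_le_II -(card_le_eql gAk).
Qed.

(** Well-ordering gives a minimizer as soon as some finite set qualifies; otherwise the infimum is
    over the empty set. *)
Lemma min_card_attained P : min_card R P = +oo \/
  exists n A, [/\ P A, (A #= `I_n)%card & min_card R P = (n%:R)%:E].
Proof.
have [exn|nex] := pselect (exists n, exists2 A, P A & (A #= `I_n)%card);
  last first.
  left; rewrite /min_card; set S := (X in ereal_inf X).
  suff -> : S = set0 by rewrite ereal_inf0.
  by apply/seteqP; split => // x [n Pn _]; apply: nex; exists n.
right; have exb : exists n, `[< exists2 A, P A & (A #= `I_n)%card >].
  by case: exn => n Pn; exists n; apply/asboolP.
case: (ex_minnP exb) => n /asboolP[A PA An] minn; exists n, A; split => //.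
apply/eqP; rewrite eq_le (min_card_le PA An)/=.
apply: le_ereal_inf_tmp => _ [k Pk <-].
by rewrite lee_fin ler_nat; apply: minn; apply/asboolP.
Qed.

End min_card.

Section limits.
Context (R : realType).

Lemma lee_limn_esup (u v : (\bar R)^nat) : (forall n, u n <= v n) ->
  limn_esup u <= limn_esup v.
Proof.
move=> uv; rewrite !limn_esup_lim.
apply: lee_lim; [exact: is_cvg_esups|exact: is_cvg_esups|].
apply: nearW => n; apply: ge_ereal_sup => _ [k nk <-].
by apply: (le_trans (uv k)); apply: ereal_sup_ubound; exists k.
Qed.

(** With [s = sqrt (n + 1)], the numerator is [2 ln s <= 2 s]; since [s ^ 2 <= 2 n] for [n >= 1],
    the quotient is at most [4 / s]. *)
Lemma cvg_ln_div : (ln n.+1%:R / n%:R : R)%R @[n --> \oo] --> (0 : R)%R.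
Proof.
apply: (@squeeze_cvgr _ _ _ _ (cst 0%R) (fun n => 4 * Num.sqrt (harmonic n))%R).
- apply: nearW => n /=; rewrite divr_ge0 ?ln_ge0 ?ler1n//=.
  case: n => [|n]; first by rewrite invr0 mulr0 mulr_ge0 ?sqrtr_ge0.
  set s := Num.sqrt (n.+2%:R : R)%R.
  have s0 : (0 < s)%R by rewrite sqrtr_gt0 ltr0n.
  have sE : (n.+2%:R = s ^+ 2 :> R)%R by rewrite sqr_sqrtr ?ler0n.
  rewrite /harmonic/= sqrtrV ?ler0n// -/s ler_pdivrMr ?ltr0n//.
  apply: (@le_trans _ _ (2 * s)%R).
    by rewrite sE lnXn// mulr2n mulrDl !mul1r lerD// ltW// ln_sublinear.
  rewrite mulrAC ler_pdivlMr//.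
  have : (n.+2%:R <= 2 * n.+1%:R :> R)%R.
    by rewrite -natrM ler_nat mul2n doubleS !ltnS -addnn leq_addl.
  by rewrite sE; lra.
- exact: cvg_cst.
- rewrite -[X in _ --> X](mulr0 4%R) -(sqrtr0 R).
  apply: cvgMr; apply: (cvg_comp _ _ (@cvg_harmonic R)).
  exact: sqrt_continuous.
Qed.

(* Divergence costs nothing: the limit is then the junk value [0], which is at
   most the limit superior of a sequence with nonnegative terms. *)
Lemma limn_le_limn_esup (u v : (\bar R)^nat) (w : R^nat) :
  (forall n, 0 <= v n) -> (forall n, u n <= (w n)%:E + v n) ->
  w @ \oo --> (0 : R)%R -> limn u <= limn_esup v.
Proof.
move=> v0 uwv w0; have [cu|du] := pselect (cvgn u); last first.
  by rewrite (dvgP du); apply: limf_esup_ge0 => //; exact: filter_not_empty.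
have we : (w n)%:E @[n --> \oo] --> (0 : \bar R).
  by apply/cvg_EFin => //; exact: nearW.
have uw : u n - (w n)%:E @[n --> \oo] --> limn u.
  by rewrite -[X in _ --> X]sube0; apply: cvgeB => //; rewrite fin_num_adde_defl.
have [_ <-] := cvg_limn_einf_sup uw.
by apply: lee_limn_esup => n; rewrite leeBlDl.
Qed.

End limits.

Lemma iterated_join_bigcap (X : topologicalType) (f : X -> X) (U : set (set X))
    (s : nat -> set X) (n : nat) :
  (forall i, U (s i)) ->
  iterated_join f U n (\bigcap_(i < n) (iter i f @^-1` s i)).
Proof.
move=> Us; rewrite /iterated_join bigcap_mkord.
elim/big_ind2: _ => [//|A V B W VA WB|i _].
  by exists A, B.
by exists (s i).
Qed.

Section spanning.
Context (R : realType) (X : metricType R) (f : X -> X).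
Implicit Types (K : set X) (e : R) (U : set (set X)).

Lemma spanning_number_ge1 n e K : K !=set0 -> 1 <= spanning_number f n e K.
Proof.
by move=> [x Kx]; apply: min_card_ge1 => F /(_ x Kx)[y Fy _]; exists y.
Qed.

Lemma bowen_entropy_term_ge0 n e K : K !=set0 ->
  0 <= ((n%:R : R)^-1)%:E * lne (spanning_number f n e K).
Proof.
move=> K0; apply: mule_ge0; first by rewrite lee_fin invr_ge0 ler0n.
by rewrite lne_ge0 spanning_number_ge1.
Qed.

(** A set that spans at a finer scale spans at every coarser one. *)
Lemma bowen_entropy_scale_noninc K : {homo bowen_entropy_scale f K :
  e e' / (e <= e')%R >-> e' <= e}.
Proof.
move=> e e' ee'; apply: lee_limn_esup => n.
apply: lee_wpmul2l; first by rewrite lee_fin invr_ge0 ler0n.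
rewrite lee_lne ?in_itv/= ?leey ?min_card_ge0//.
apply: min_card_subset => F FK x Kx; have [y Fy xy] := FK x Kx.
by exists y => // j jn; exact: le_trans (xy j jn) ee'.
Qed.

(** By monotonicity the limit at [0] exists and is the supremum over positive scales. *)
Lemma bowen_entropy_scale_le K e : (0 < e)%R ->
  bowen_entropy_scale f K e <= bowen_entropy_compact f K.
Proof.
move=> e0.
have cvg_sup :=
  @nonincreasing_at_right_cvge R (bowen_entropy_scale f K) 0%R +oo%O.
rewrite /bowen_entropy_compact (cvg_lim _ (cvg_sup _ _))//.
  by apply: ereal_sup_ubound; exists e => //=; rewrite in_itv/= e0.
by move=> x y _ _; exact: bowen_entropy_scale_noninc.
Qed.

(** The near-covering form of compactness makes a local radius uniform: if the ball of radius [d] at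
    [x] lies in [A], then radius [d / 2] works at every centre within [d / 2] of [x]. *)
Lemma lebesgue_number K U : compact K -> is_cover U ->
  (forall A, U A -> open A) ->
  exists2 e, (0 < e)%R & forall x, K x -> exists2 A, U A & ball x e `<=` A.
Proof.
move=> /compact_near_coveringP cK covU oU.
have : \forall e \near (0 : R)^'+,
    K `<=` (fun x => exists2 A, U A & ball x e `<=` A).
  apply: cK => x _; have [A UA Ax] : (\bigcup_(A in U) A) x by rewrite covU.
  have /nbhs_ballP[d /= d0 dA] : nbhs x A.
    by exact: open_nbhs_nbhs (conj (oU _ UA) Ax).
  near=> y e; exists A => // z yz; apply: dA.
  rewrite (splitr d); apply: (@ball_triangle _ _ y).
    by near: y; apply: nbhsx_ballx; rewrite divr_gt0.
  apply: le_ball yz => /=; near: e; apply: nbhs_right_le.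
  by rewrite divr_gt0.
move=> He; near (0 : R)^'+ => e.
exists e; first by near: e; exact: nbhs_right_gt.
by near: e.
Unshelve. all: by end_near. Qed.

(* A ball either meets [~` A0], where compactness gives a Lebesgue number, or
   lies in [A0]. *)
Lemma cocompact_lebesgue_number U (A0 : set X) : cocompact_open_cover U -> U A0 ->
  exists2 e, (0 < e)%R &
    forall x, exists2 A, U A & [set y | mdist y x <= e]%R `<=` A.
Proof.
move=> [covU UP] UA0.
have [e e0 Ke] := lebesgue_number (UP _ UA0).2 covU (fun A UA => (UP A UA).1).
(* Two steps of length at most [e / 3], from [z] to [x] to [y], stay strictly below [e], as the open
   ball around [z] requires. *)
exists (e / 3)%R; first by rewrite divr_gt0.
move=> x; have [[z nz zx]|nx] :=
    pselect (exists2 z, ~ A0 z & (mdist z x <= e / 3)%R).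
  have [A UA zA] := Ke z nz; exists A => // y /= yx; apply: zA.
  rewrite ballEmdist/=; apply: (le_lt_trans (metric_triangle z x y)).
  by rewrite [mdist x y]metric_sym; lra.
by exists A0 => // y /= yx; apply: contrapT => ny; apply: nx; exists y.
Qed.

(* [x] is classified by the first time [i] its orbit enters [~` A0 `<=` K] (or
   [i = n]) and a point spanning [iter i f x]: before [i] the orbit stays in
   [A0], afterwards it follows that of the spanning point. *)
Lemma cover_number_le_spanning U (A0 : set X) K e n :
  U A0 -> ~` A0 `<=` K -> K !=set0 ->
  (forall x, exists2 A, U A & [set y | mdist y x <= e]%R `<=` A) ->
  cover_number R (iterated_join f U n) <=
    (n.+1%:R)%:E * spanning_number f n e K.
Proof.
move=> UA0 A0K [x0 Kx0] eU.
have /choice[L /all_and2[UL eL]] : forall x, exists A : set X,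
    U A /\ [set y | mdist y x <= e]%R `<=` A.
  by move=> x; have [A UA xA] := eU x; exists A.
rewrite /spanning_number.
have [->|[m [F [FK Fm ->]]]] := min_card_attained R (spanning_set f n e K).
  by rewrite gt0_muley ?leey// lte_fin ltr0n.
have [h Fh] := card_eq_I_enum x0 Fm.
rewrite -EFinM -natrM.
(* The index [k = i * m + q] encodes the entry time [i <= n] and the number [q < m] of a spanning
   point; [s k] is the resulting itinerary. *)
pose s k (j : nat) : set X :=
  if (j < k %/ m)%N then A0 else L (iter (j - k %/ m) f (h (k %% m)%N)).
apply: (@min_card_image_le _ _ _ _ `I_(n.+1 * m)
  (fun k => \bigcap_(i < n) (iter i f @^-1` s k i))); first exact: card_lexx.
split=> [_ [k _ <-]|].
  by apply: iterated_join_bigcap => i; rewrite /s; case: ifP.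
apply/seteqP; split => // x _.
have [i [le_in lt_i K_i]] : exists i, [/\ (i <= n)%N,
    forall j, (j < i)%N -> A0 (iter j f x) &
    exists2 z, K z & forall j, (i <= j < n)%N -> iter j f x = iter (j - i) f z].
  (* Here [i] is the first visit to [K] itself; earlier points avoid [K], hence lie in [A0]. *)
  have [ex|nex] := pselect (exists i, `[< (i < n)%N /\ K (iter i f x) >]).
    case: (ex_minnP ex) => i /asboolP[i_n Ki] mini; exists i; split.
    - exact: ltnW.
    - move=> j ji; apply: contrapT => nA; suff: (i <= j)%N by rewrite leqNgt ji.
      by apply/mini/asboolP; split; [exact: ltn_trans ji i_n|exact: A0K].
    - by exists (iter i f x) => // j /andP[ij _]; rewrite -iterD subnK.
  (* Without a visit before [n], the range [n <= j < n] is empty and any point of [K] serves as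
     [z]. *)
  exists n; split => // [j jn|].
    apply: contrapT => nA; apply: nex; exists j; apply/asboolP.
    by split => //; exact: A0K.
  by exists x0 => // j; case: (leqP n j).
have {K_i} [z Kz xz] := K_i; have [y /Fh[q /= qm <-{y}] zq] := FK z Kz.
exists (\bigcap_(j < n) (iter j f @^-1` s (i * m + q)%N j)).
  exists (i * m + q)%N => //=.
  rewrite mulSnr (leq_trans (n := (i * m + m)%N)) ?ltn_add2l//.
  by rewrite leq_add2r leq_mul2r le_in orbT.
have m0 : (0 < m)%N by exact: leq_ltn_trans qm.
move=> j /= jn; rewrite /s divnMDl// divn_small// addn0 modnMDl modn_small//.
case: ltnP => [/lt_i//|ij]; apply: eL => /=; rewrite xz ?ij//.
by apply: zq; exact: leq_ltn_trans (leq_subr _ _) jn.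
Qed.

End spanning.

Theorem theorem5p3 (R : realType) (X : metricType R) (hX : [set: X] !=set0)
    (f : X -> X) (hf : perfect_map f) :
  cocompact_entropy R f <= bowen_entropy f.
Proof.
have [x0 _] := hX.
apply: ge_ereal_sup => _ [U coU <-].
have [A0 UA0 _] : (\bigcup_(A in U) A) x0 by rewrite coU.1.
(* Adding [x0] keeps [K] non-empty even when [A0] is the whole space. *)
pose K := ~` A0 `|` [set x0].
have K0 : K !=set0 by exists x0; right.
have [e e0 eU] := cocompact_lebesgue_number coU UA0.
apply: (@le_trans _ _ (bowen_entropy_compact f K)); last first.
  apply: ereal_sup_ubound; exists K => //; split => //.
  by apply: compactU; [exact: (coU.2 _ UA0).2|exact: compact_set1].
apply: (le_trans _ (bowen_entropy_scale_le f K e0)).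
apply: limn_le_limn_esup (@cvg_ln_div R) => n.
  exact: bowen_entropy_term_ge0.
have n0 : 0 <= ((n%:R : R)^-1)%:E by rewrite lee_fin invr_ge0 ler0n.
(* Positivity of the spanning number, possibly [+oo], lets the logarithm of the product split into a
   sum. *)
have r1 := spanning_number_ge1 f n e K0.
rewrite mulrC EFinM -muleDr ?fin_num_adde_defr//.
apply: lee_wpmul2l => //.
rewrite -lne_EFin ?ltr0n// -lneM ?in_itv/= ?leey ?lte_fin ?ltr0n ?andbT//.
  rewrite lee_lne ?in_itv/= ?leey ?andbT ?min_card_ge0//.
    by apply: cover_number_le_spanning UA0 _ K0 eU; left.
  by apply: mule_ge0; [rewrite lee_fin|exact: min_card_ge0].
exact: lt_le_trans r1.
Qed.
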